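(* Let $m\in\mathbb{N}$ (with $m=0$ allowed), let $a>-1$, and let $w$ be such that $a=\tfrac12(w^{2}+w^{-2})$. Let $\mathbf{q}=(w,\ldots,w,w^{-1},\ldots,w^{-1})$ be the $(2m+2)$-tuple containing $m+1$ copies of $w$ and $m+1$ copies of $w^{-1}$. Then the quartic integral $N_{0,4}(a;m)$ is given by $$N_{0,4}(a;m)=\frac{\pi}{2}\,\frac{s_{\lambda(2m+1)}(\mathbf{q})}{s_{\lambda(2m+2)}(\mathbf{q})}.$$
   Context: $N_{0,4}(a;m)=\int_{0}^{\infty}\frac{dx}{(x^{4}+2ax^{2}+1)^{m+1}}$. For an integer $n\ge1$, $\lambda(n)$ denotes the partition $(n-1,n-2,\ldots,1)$ (the empty partition if $n=1$). Partitions are padded with zeros to have as many entries as there are variables. For $N$ variables $\mathbf{q}=(q_1,\ldots,q_N)$ and a partition $\mu$ with at most $N$ parts, the Schur function is $$s_\mu(\mathbf{q})=\frac{a_{\mu+\lambda(N)}(\mathbf{q})}{a_{\lambda(N)}(\mathbf{q})},\qquad a_\mu(\mathbf{q})=\det\left(q_i^{\mu_j}\right)_{1\le i,j\le N}.$$ The quotient is a symmetric polynomial in $q_1,\dots,q_N$, and it is this polynomial that is evaluated when some of the $q_i$ coincide.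
   Formalization: The formal statement adds the hypothesis that w has positive real part; without it the formula fails, since replacing w by −w keeps a and the integral but changes the sign of the Schur quotient (e.g. m=0, a=1, w=−1 gives −π/4 instead of π/4). *)

(* Defs.v *)
From HB Require Import structures.
From mathcomp Require Import all_boot all_order all_algebra.
From mathcomp Require Import complex.
(* The notations of mpoly clash with those of MathComp-Analysis. *)
From mathcomp Require Import -(notations) mpoly.
From mathcomp Require Import all_classical all_reals all_analysis.

Set Implicit Arguments.
Unset Strict Implicit.
Unset Printing Implicit Defensive.

Import Order.TTheory GRing.Theory Num.Theory.
Import numFieldNormedType.Exports.
Local Open Scope classical_set_scope.
Local Open Scope ring_scope.

Definition quartic_integral (R : realType) (a : R) (m : nat) : R :=
  \int[@lebesgue_measure R]_(x in `[0, +oo[)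
    ((x ^+ 4 + 2 * a * x ^+ 2 + 1) ^+ m.+1)^-1.

(* (n-1, n-2, ..., 1) *)
Definition staircase (n : nat) : seq nat := rev (iota 1 n.-1).

(* det (q_i ^ mu_j) as a polynomial in the N indeterminates q_i *)
Definition alternant (R : idomainType) (N : nat) (mu : nat -> nat) : mpoly N R :=
  \det (\matrix_(i < N, j < N) (mpolyX R (mnm1 i) ^+ mu j)).

(* The polynomial quotient a_(mu + staircase N) / a_(staircase N): the divisor
   is nonzero and [mpoly N R] is an integral domain, so at most one polynomial
   satisfies the defining equation. The default value 0 of [xget] would be
   taken only if the division were not exact. The default value 0 of [nth] pads
   the partitions with zeros. *)
Definition schur (R : idomainType) (N : nat) (mu : seq nat) : mpoly N R :=
  xget 0 [set s : mpoly N R |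
    s * alternant R N (nth 0%N (staircase N)) =
    alternant R N (fun j => (nth 0%N mu j + nth 0%N (staircase N) j)%N)].

(* For [a > -1] the equation [a = (w^2 + w^-2) / 2] determines w up to inversion
   and sign. The tuple is insensitive to inversion up to order, but the quotient
   of Schur functions, homogeneous of degree -(2m+1), changes sign with w: w has
   to be taken with positive real part (all solutions have [Re w != 0]). *)
Definition qtuple (R : rcfType) (m : nat) (w : R[i]) : 'I_(2 * m + 2) -> R[i] :=
  fun i => if (i < m.+1)%N then w else w^-1.

Arguments qtuple {R} m w i.

(* Main.v *)
Require Import Defs.
From mathcomp Require Import all_boot all_order all_algebra.
From mathcomp Require Import complex.
From mathcomp Require Import -(notations) mpoly.
From mathcomp Require Import all_classical all_reals all_analysis.
From mathcomp Require Import perm ring lra zify.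

(* Put E = prod_i (X - q_i) = (X^2 - 2bX + 1)^(m+1), with 2b = w + 1/w > 0, and
   N = 2m+2. Reducing powers of X modulo E writes every alternant as the Vandermonde
   determinant times a determinant of remainders modulo E, and the latter makes
   sense when the q_i coincide: it is the Schur function. E(X) and E(-X) are
   coprime, so there is C with deg C < N such that E C = 1 - X U(X^2). Expanding
   1 = X U(X^2) mod E in the column of X^0 turns the numerator determinant, with
   columns X^(2N-3), ..., X^3, X, 1, into C_(N-1) times the one with columns
   X^(2N-2), ..., X^2, 1, hence the Schur quotient is C_(N-1).
   On the other side, 1 / (x^4 + 2ax^2 + 1)^(m+1) is the real part of C / Q^(m+1)
   at ix, where Q = X^2 + 2bX + 1. Modulo derivatives of rational functions
   vanishing at infinity, such a fraction reduces to one with denominator Q without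
   changing the coefficient C_(N-1), and only (X + b) / Q contributes, by pi / 2. *)

Set Implicit Arguments.
Unset Strict Implicit.
Unset Printing Implicit Defensive.

Import Order.TTheory GRing.Theory Num.Theory.
Import numFieldNormedType.Exports.
Local Open Scope classical_set_scope.
Local Open Scope ring_scope.
Local Open Scope complex_scope.

(** * Schur functions as determinants of remainders *)

Section Remainders.
Import Pdiv.CommonRing Pdiv.RingMonic.

(** The image of a Euclidean division is again one: a monic divisor keeps its size, so the image of
    the remainder stays small enough. *)
Lemma map_rmodp_monic (R S : nzRingType) (f : {rmorphism R -> S})
    (p d : {poly R}) : d \is monic ->
  map_poly f (rmodp p d) = rmodp (map_poly f p) (map_poly f d).
Proof.
move=> dm; have dfm := monic_map f dm.
rewrite [in RHS](rdivp_eq dm p) rmorphD rmorphM /= rmodp_addl_mul_small //.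
rewrite [size (map_poly f d)]size_map_poly_id0; last first.
  by rewrite (monicP dm) rmorph1 oner_neq0.
by rewrite (leq_ltn_trans (size_poly _ _)) // ltn_rmodp monic_neq0.
Qed.

Definition root_poly (R : comNzRingType) N (q : 'I_N -> R) : {poly R} :=
  \prod_(i < N) ('X - (q i)%:P).

Lemma root_poly_monic (R : comNzRingType) N (q : 'I_N -> R) : root_poly q \is monic.
Proof. exact: monic_prod_XsubC. Qed.

Lemma size_root_poly (R : comNzRingType) N (q : 'I_N -> R) : size (root_poly q) = N.+1.
Proof. by rewrite size_prod_XsubC [index_enum _]unlock -enumT size_enum_ord. Qed.

Lemma map_root_poly (R S : comNzRingType) (f : {rmorphism R -> S}) N
    (q : 'I_N -> R) : map_poly f (root_poly q) = root_poly (f \o q).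
Proof.
rewrite /root_poly rmorph_prod; apply: eq_bigr => i _.
by rewrite rmorphB /= map_polyX map_polyC.
Qed.

(* Column j lists the coefficients of [p j] modulo [d], leading ones first. *)
Definition remmx (R : nzRingType) N (d : {poly R}) (p : 'I_N -> {poly R}) :
    'M[R]_N :=
  \matrix_(k, j) (rmodp (p j) d)`_(rev_ord k).

(** The exponents decrease along each row, so that the determinant is the alternant of the staircase
    with no sign to track. *)
Definition vdm (R : nzRingType) N (q : 'I_N -> R) : 'M[R]_N :=
  \matrix_(i, k) q i ^+ rev_ord k.

(** As [root_poly q] vanishes at each [q i], [p j] and its remainder agree there, and evaluating the
    remainder is a product with the Vandermonde matrix. *)
Lemma horner_remmx (R : comNzRingType) N (q : 'I_N -> R)
    (p : 'I_N -> {poly R}) :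
  \matrix_(i, j) (p j).[q i] = vdm q *m remmx (root_poly q) p.
Proof.
apply/matrixP => i j; rewrite !mxE.
rewrite {1}(rdivp_eq (root_poly_monic q) (p j)) hornerD hornerM.
have -> : (root_poly q).[q i] = 0.
  by rewrite /root_poly horner_prod (bigD1 i) //= !hornerE subrr mul0r.
rewrite mulr0 add0r (@horner_coef_wide _ N); last first.
  by rewrite -ltnS -(size_root_poly q) ltn_rmodp monic_neq0 ?root_poly_monic.
rewrite (reindex_inj rev_ord_inj) /=; apply: eq_bigr => k _.
by rewrite !mxE mulrC.
Qed.

Lemma map_remmx (R S : comNzRingType) (f : {rmorphism R -> S}) N
    (q : 'I_N -> R) (p : 'I_N -> {poly R}) :
  map_mx f (remmx (root_poly q) p) =
  remmx (root_poly (f \o q)) (fun j => map_poly f (p j)).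
Proof.
apply/matrixP => k j; rewrite !mxE.
by rewrite -map_root_poly -map_rmodp_monic ?root_poly_monic // coef_map.
Qed.

Lemma vdm_det_neq0 (R : idomainType) N (q : 'I_N -> R) :
  injective q -> \det (vdm q) != 0.
Proof.
move=> q_inj.
have -> : vdm q = col_perm (perm rev_ord_inj) (Vandermonde N (\row_i q i))^T.
  by apply/matrixP => i k; rewrite !mxE permE.
rewrite col_permE det_mulmx det_perm det_tr mulf_neq0 ?signr_eq0 //.
rewrite det_Vandermonde; apply/prodf_neq0 => i _; apply/prodf_neq0 => j ij.
rewrite !mxE subr_eq0; apply/eqP => /q_inj ji.
by rewrite ji ltnn in ij.
Qed.

Lemma nth_staircase n k : nth 0%N (staircase n) k = (n.-1 - k)%N.
Proof.
rewrite /staircase; have [kn|nk] := ltnP k n.-1; last first.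
  by rewrite nth_default ?size_rev ?size_iota //; apply/esym/eqP; rewrite subn_eq0.
by rewrite nth_rev size_iota // nth_iota; lia.
Qed.

Lemma alternantE (R : idomainType) N (mu : nat -> nat) :
  alternant R N mu = \det (vdm (fun i => mpolyX R (mnm1 i))) *
    \det (remmx (root_poly (fun i => mpolyX R (mnm1 i))) (fun j : 'I_N => 'X^(mu j))).
Proof.
rewrite /alternant -det_mulmx -horner_remmx; congr (\det _).
by apply/matrixP => i j; rewrite !mxE hornerXn.
Qed.

Lemma mpolyX1_inj (R : nzRingType) N :
  injective (fun i : 'I_N => mpolyX R (mnm1 i)).
Proof.
move=> i j /(congr1 (mcoeff (mnm1 i))); rewrite !mcoeffX eqxx.
case: eqP => [/eqP|_ /eqP]; last by rewrite oner_eq0.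
by rewrite eq_mnm1 => /eqP.
Qed.

(** Remainders modulo a monic polynomial commute with ring morphisms. This gives access to
    coinciding values, where the Vandermonde determinant vanishes. *)
Lemma meval_det_remmx (R : idomainType) N (q : 'I_N -> R) (nu : nat -> nat) :
  meval q (\det (remmx (root_poly (fun i => mpolyX R (mnm1 i)))
    (fun j : 'I_N => 'X^(nu j)))) =
  \det (remmx (root_poly q) (fun j : 'I_N => 'X^(nu j))).
Proof.
rewrite -det_map_mx map_remmx; congr (\det _).
rewrite (_ : root_poly (meval q \o _) = root_poly q); last first.
  by apply: eq_bigr => i _ /=; rewrite mevalXU.
by apply/matrixP => k j; rewrite !mxE map_polyXn.
Qed.

Lemma meval_schur (R : idomainType) N (q : 'I_N -> R) (mu : seq nat) :
  meval q (schur R N mu) =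
  \det (remmx (root_poly q) (fun j : 'I_N => 'X^(nth 0%N mu j + (N.-1 - j)))).
Proof.
pose X := (fun i : 'I_N => mpolyX R (mnm1 i)).
pose nu := (fun j => nth 0%N mu j + nth 0%N (staircase N) j)%N.
(* The indeterminates are distinct, so the Vandermonde factor can be cancelled before evaluating. *)
have vN0 : \det (vdm X) != 0 by apply/vdm_det_neq0/mpolyX1_inj.
have st1 : alternant R N (nth 0%N (staircase N)) = \det (vdm X).
  congr (\det _); apply/matrixP => i k; rewrite !mxE nth_staircase /=.
  by congr (_ ^+ _); lia.
have -> : schur R N mu = \det (remmx (root_poly X) (fun j : 'I_N => 'X^(nu j))).
  have ex : \det (remmx (root_poly X) (fun j : 'I_N => 'X^(nu j))) *
      alternant R N (nth 0%N (staircase N)) = alternant R N nu.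
    apply: etrans (esym (alternantE R N nu)).
    by apply: etrans (congr1 _ st1) _; exact: mulrC.
  apply: (mulIf vN0); rewrite -st1 ex.
  (* By [ex] the defining equation has a solution, so [xget] does not return its default. *)
  by rewrite /schur; case: xgetP => [s _ //|/(_ _ ex)].
rewrite meval_det_remmx; congr (\det _).
by apply/matrixP => k j; rewrite !mxE /nu nth_staircase.
Qed.

(** The factor is the determinant of multiplication by X modulo [root_poly q]. For indeterminates,
    row i of the alternant is multiplied by [X i]; cancelling the Vandermonde determinant and then
    evaluating covers repeated values. *)
Lemma det_remmx_shift (R : idomainType) N (q : 'I_N -> R) (nu : nat -> nat) :
  \det (remmx (root_poly q) (fun j : 'I_N => 'X^((nu j).+1))) =
  (\prod_i q i) * \det (remmx (root_poly q) (fun j : 'I_N => 'X^(nu j))).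
Proof.
pose X := (fun i : 'I_N => mpolyX R (mnm1 i)).
have vN0 : \det (vdm X) != 0 by apply/vdm_det_neq0/mpolyX1_inj.
have gen : \det (remmx (root_poly X) (fun j : 'I_N => 'X^((nu j).+1))) =
    (\prod_i X i) * \det (remmx (root_poly X) (fun j : 'I_N => 'X^(nu j))).
  have e : alternant R N (fun j => (nu j).+1) = (\prod_i X i) * alternant R N nu.
    rewrite /alternant -[\prod_i _](_ : \det (diag_mx (\row_i X i)) = _); last first.
      by rewrite det_diag; apply: eq_bigr => i _; rewrite mxE.
    rewrite -det_mulmx mul_diag_mx; congr (\det _).
    by apply/matrixP => i j; rewrite !mxE exprS.
  move: e; rewrite (alternantE R N nu) (alternantE R N (fun j => (nu j).+1)).
  by move=> e; apply: (mulfI vN0); rewrite [LHS]e mulrCA.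
apply: etrans (esym (meval_det_remmx q (fun j => (nu j).+1))) _.
apply: etrans (congr1 (meval q) gen) _; apply: etrans (mevalM _ _ _) _.
congr (_ * _); last exact: meval_det_remmx.
by rewrite rmorph_prod; apply: eq_bigr => i _; rewrite /= mevalXU.
Qed.

End Remainders.

(** * The quotient of the two staircase determinants, in [N.+1] variables *)

Section Ratio.
Import Pdiv.CommonRing Pdiv.RingMonic.


Variables (F : fieldType) (N : nat) (q : 'I_N.+1 -> F) (C U : {poly F}).
Hypothesis oddN : odd N.
Hypothesis sizeC : (size C <= N.+1)%N.
Hypothesis sizeU : (size U <= N.+1)%N.
Hypothesis bezout : root_poly q * C + 'X * (U \Po 'X^2) = 1.

Let E := root_poly q.
Let monE : E \is monic := root_poly_monic q.
Let sizeE : size E = N.+2 := size_root_poly q.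

Let UE : 'X * (U \Po 'X^2) = \sum_(k < N.+1) U`_k *: 'X^(k.*2.+1).
Proof.
rewrite comp_polyE (big_ord_widen N.+1 (fun k => U`_k *: 'X^2 ^+ k)) //.
rewrite big_mkcond mulr_sumr; apply: eq_bigr => k _.
case: ltnP => [_|sk]; last by rewrite nth_default // mulr0 scale0r.
by rewrite -scalerAr -exprM mul2n -exprS.
Qed.

(** Compare coefficients of degree 2N+1 in [bezout], where E is monic of degree N+1 and C has degree
    at most N. *)
Let U_lead : U`_N = - C`_N.
Proof.
have := congr1 (fun p : {poly F} => p`_(N.*2.+1)) bezout.
rewrite coefD coef1 UE coef_sum.
have -> : \sum_(k < N.+1) (U`_k *: 'X^(k.*2.+1))`_N.*2.+1 = U`_N.
  rewrite (bigD1 ord_max) //= coefZ coefXn eqxx mulr1 big1 ?addr0 // => k.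
  rewrite -val_eqE /= coefZ coefXn => kN; rewrite (_ : _ == _ = false) ?mulr0 //.
  by lia.
have -> : (E * C)`_N.*2.+1 = C`_N.
  have lt1 : (N.+1 < N.*2.+2)%N by lia.
  rewrite coefM (bigD1 (Ordinal lt1)) //= big1 ?addr0.
    have := monicP monE; rewrite lead_coefE sizeE /= => ->.
    by rewrite mul1r; have -> : (N.*2.+1 - N.+1 = N)%N by lia.
  move=> i; rewrite -val_eqE /= => iN.
  have [Ni|iN'] := leqP N.+2 i; first by rewrite (nth_default _ (n := i)) ?mul0r ?sizeE.
  by rewrite [C`__]nth_default ?mulr0 // (leq_trans sizeC) //; lia.
by move/eqP; rewrite addrC addr_eq0 => /eqP.
Qed.

(** The columns on the left are X^(2N-1), ..., X^3, X, 1. Those on the right may be multiplied by X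
    since the product of the [q i] is 1, and become X^(2N+1), ..., X^3, X. The transition matrix [T]
    has determinant C_N. *)
Lemma det_remmx_odd_even : \prod_i q i = 1 ->
  \det (remmx (root_poly q) (fun j : 'I_N.+1 => 'X^((N.-1 - j) + (N - j)))) =
  C`_N *
  \det (remmx (root_poly q) (fun j : 'I_N.+1 => 'X^((N - j) + (N - j)))).
Proof.
move=> q1.
have := det_remmx_shift q (fun j => (N - j) + (N - j))%N.
rewrite q1 mul1r => <-.
pose T : 'M[F]_N.+1 := \matrix_(k, j)
  if j == ord_max then U`_(rev_ord k) else (k == j.+1 :> nat)%:R.
have -> : remmx (root_poly q) (fun j : 'I_N.+1 => 'X^((N.-1 - j) + (N - j))) =
    remmx (root_poly q) (fun j : 'I_N.+1 => 'X^(((N - j) + (N - j)).+1)) *m T.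
  apply/matrixP => k j; rewrite !mxE; case: (eqVneq j ord_max) => [->|jN].
    (* For j = N both truncated differences are 0: the last column is that of 1, which is X U(X^2)
       modulo E. *)
    rewrite /= (_ : _ + _ = 0)%N; last by lia.
    rewrite expr0 -bezout mulrC rmodpD // rmodp_mull // add0r UE rmodp_sum //.
    rewrite coef_sum (reindex_inj rev_ord_inj) /=.
    apply: eq_bigr => i _; rewrite !mxE eqxx /= rmodpZ // coefZ mulrC subSS.
    by rewrite addnn.
  have jN' : (j.+1 < N.+1)%N.
    by have := ltn_ord j; move: jN; rewrite -val_eqE /=; lia.
  rewrite (bigD1 (Ordinal jN')) //= big1 ?addr0.
    rewrite !mxE (negPf jN) /= eqxx mulr1.
    by have -> : (N.-1 - j + (N - j) = (N - j.+1 + (N - j.+1)).+1)%N by lia.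
  by move=> i; rewrite -val_eqE /= !mxE (negPf jN) => /negPf ->; rewrite mulr0.
rewrite det_mulmx mulrC; congr (_ * _).
(* The first row of [T] has the single entry U_N = -C_N, in the last column; the cofactor sign
   (-1)^N = -1 compensates, and the minor is the identity. *)
rewrite (expand_det_row _ ord0) (bigD1 ord_max) //= big1 ?addr0; last first.
  by move=> j jN; rewrite mxE (negPf jN) /= mul0r.
rewrite mxE eqxx /= subn1 /= U_lead /cofactor /= add0n -signr_odd oddN expr1.
rewrite [row' _ _](_ : _ = 1%:M) ?det1 ?mulr1 ?mulN1r ?mulrN1 ?opprK //.
apply/matrixP => i j; rewrite !mxE -val_eqE /= /bump leq0n.
have -> : (N <= j)%N = false by have := ltn_ord j; lia.
by rewrite add1n add0n eqSS ltn_eqF.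
Qed.

(** A kernel vector gives an even polynomial V of degree at most 2N divisible by E(X), hence by
    E(-X). These are coprime and their product has degree 2N+2, so V = 0. *)
Lemma det_remmx_even_neq0 : 2 != 0 :> F ->
  \det (remmx (root_poly q) (fun j : 'I_N.+1 => 'X^((N - j) + (N - j)))) != 0.
Proof.
move=> two; rewrite -det_tr; apply/det0P => -[v v0 /rowP vM].
pose V : {poly F} := \sum_(j < N.+1) v 0 j *: 'X^((N - j) + (N - j)).
have sV : (size V <= N.*2.+1)%N.
  apply: (leq_trans (size_sum _ _ _)); apply/bigmax_leqP => j _.
  by rewrite (leq_trans (size_scale_leq _ _)) // size_polyXn; lia.
have EV : rmodp V E = 0.
  apply/polyP => i; rewrite coef0.
  have [Ni|iN] := leqP N.+1 i.
    by rewrite nth_default // (leq_trans _ Ni) // -ltnS -sizeE ltn_rmodp monic_neq0.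
  have := vM (rev_ord (Ordinal iN)); rewrite !mxE; apply: etrans.
  rewrite rmodp_sum // coef_sum; apply: eq_bigr => j _.
  by rewrite !mxE rev_ordK /= rmodpZ // coefZ.
have [K VK] : exists K, V = K * E by apply/(rdvdpP monE)/eqP.
have Vm : V \Po - 'X = V.
  rewrite rmorph_sum; apply: eq_bigr => j _ /=.
  rewrite comp_polyZ rmorphXn /= comp_polyX exprNn -signr_odd addnn odd_double expr0.
  by rewrite mul1r.
(* Adding to [bezout] its image under X -> -X removes the odd term X U(X^2). *)
have bez2 : E * C + (E \Po - 'X) * (C \Po - 'X) = 2.
  have := congr1 (fun p : {poly F} => p \Po - 'X) bezout.
  rewrite rmorphD !rmorphM /= -comp_polyA rmorphXn /= comp_polyX sqrrN.
  rewrite rmorph1 => b2; have := bezout; rewrite -/E in b2 *.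
  move=> b1; rewrite -[2]/(1 + 1) -{1}b1 -b2; ring.
have sizeEm : size (E \Po - 'X) = N.+2.
  by rewrite size_comp_poly2 ?sizeE // size_polyN size_polyX.
have V2 : 2 * V = E * (E \Po - 'X) * (C * (K \Po - 'X) + (C \Po - 'X) * K).
  rewrite -bez2 mulrDl {1}(_ : V = (E \Po - 'X) * (K \Po - 'X)); last first.
    by rewrite -Vm {1}VK rmorphM /= mulrC.
  by rewrite VK; ring.
have V0 : V = 0.
  have : 2 * V = 0.
    apply/eqP; rewrite V2; apply: contraTT sV; rewrite -ltnNge => nz.
    have -> : size V = size (2 * V).
      by rewrite -[2](polyC_natr _ 2) mul_polyC size_scale.
    rewrite V2; move: nz; rewrite mulf_eq0 negb_or => /andP[n1 n2].
    rewrite size_mul // (size_mul (monic_neq0 monE)); last by rewrite -size_poly_eq0 sizeEm.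
    by rewrite sizeE sizeEm; move: n2; rewrite -size_poly_gt0; lia.
  by move/eqP; rewrite mulf_eq0 -[2](polyC_natr _ 2) polyC_eq0 (negPf two) => /eqP.
case/eqP: v0; apply/rowP => j; rewrite mxE.
have := congr1 (fun p : {poly F} => p`_((N - j) + (N - j))) V0.
rewrite coef0 coef_sum (bigD1 j) //= coefZ coefXn eqxx mulr1 big1 ?addr0 // => i.
rewrite -val_eqE /= coefZ coefXn => ij; rewrite (_ : _ == _ = false) ?mulr0 //.
by have := ltn_ord i; have := ltn_ord j; lia.
Qed.

End Ratio.

(** * Antiderivatives on the half-line *)

Section Deriv.
Variable R : realType.
Implicit Types (f g : R -> R) (x : R).

Lemma is_deriveD_fun f g x df dg : is_derive x 1 f df -> is_derive x 1 g dg ->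
  is_derive x 1 (fun y => f y + g y) (df + dg).
Proof. exact: is_deriveD. Qed.

Lemma is_deriveM_fun f g x df dg : is_derive x 1 f df -> is_derive x 1 g dg ->
  is_derive x 1 (fun y => f y * g y) (df * g x + f x * dg).
Proof.
move=> hf hg; apply: (is_derive_eq (is_deriveM hf hg)).
by rewrite addrC mulrC.
Qed.

Lemma is_deriveX_fun f n x df : is_derive x 1 f df ->
  is_derive x 1 (fun y => f y ^+ n) (n%:R * f x ^+ n.-1 * df).
Proof.
move=> hf; have -> : (fun y => f y ^+ n) = f ^+ n.
  by apply/funext => y; rewrite fctE.
exact: is_deriveX.
Qed.

Lemma is_deriveV_fun f x df : f x != 0 -> is_derive x 1 f df ->
  is_derive x 1 (fun y => (f y)^-1) (- (f x) ^- 2 * df).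
Proof. by move=> f0 hf; have := is_deriveV f0 hf. Qed.

Lemma is_derive_comp_fun g f x dg df : is_derive (f x) 1 g dg ->
  is_derive x 1 f df -> is_derive x 1 (fun y => g (f y)) (dg * df).
Proof. by move=> hg hf; apply: is_derive1_comp. Qed.

Lemma is_derive_eq_fun f x df df' : is_derive x 1 f df -> df = df' ->
  is_derive x 1 f df'.
Proof. by move=> ? <-. Qed.

Lemma is_derive_continuous f x df : is_derive x 1 f df -> {for x, continuous f}.
Proof.
by move=> [df' _]; apply/differentiable_continuous/derivable1_diffP.
Qed.

(* Working with antiderivatives instead of integrals spares the integrability of
   the intermediate functions, which change sign. *)
Definition has_variation f (l : R) : Prop :=
  exists H : R -> R, [/\ forall x, 0 < x -> is_derive x 1 H (f x),
    H x @[x --> 0^'+] --> (0 : R) & H x @[x --> +oo] --> l].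

Lemma eq_has_variation f g l : (forall x, 0 < x -> f x = g x) ->
  has_variation f l -> has_variation g l.
Proof.
by move=> fg [H [dH H0 Hy]]; exists H; split => // x x0; rewrite -fg //; exact: dH.
Qed.

Lemma has_variationD f g k l : has_variation f k -> has_variation g l ->
  has_variation (fun x => f x + g x) (k + l).
Proof.
move=> [F [dF F0 Fy]] [G [dG G0 Gy]]; exists (fun x => F x + G x); split.
- by move=> x x0; apply: is_deriveD_fun; [exact: dF|exact: dG].
- by have := cvgD F0 G0; rewrite addr0; exact.
- exact: cvgD.
Qed.

Lemma has_variationZ c f l : has_variation f l -> has_variation (fun x => c * f x) (c * l).
Proof.
move=> [F [dF F0 Fy]]; exists (fun x => c * F x); split.
- move=> x x0; apply: is_derive_eq.
    exact: (is_deriveM_fun (is_derive_cst c x 1) (dF x x0)).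
  by rewrite mul0r add0r.
- by have := cvgM (cvg_cst c) F0; rewrite mulr0; exact.
- exact: (cvgM (cvg_cst c) Fy).
Qed.

Lemma cvg_pinfty0 f M : (forall x, 1 <= x -> `|f x| <= M / x) ->
  f x @[x --> +oo] --> (0 : R).
Proof.
move=> fM; apply/cvgr0Pnorm_le => e e0.
near=> x.
have x1 : 1 <= x by near: x; apply: nbhs_pinfty_ge; exact: num_real.
apply: (le_trans (fM x x1)); rewrite ler_pdivrMr; last lra.
by rewrite mulrC -ler_pdivrMr.
Unshelve. all: by end_near. Qed.

(** Nonnegativity gives the fundamental theorem of calculus on the half-line without a separate
    integrability argument. *)
Lemma variation_integral f l : (forall x, 0 <= x -> 0 <= f x) ->
  (forall x, 0 <= x -> {for x, continuous f}) -> has_variation f l ->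
  \int[@lebesgue_measure R]_(x in `[0, +oo[) f x = l.
Proof.
move=> f0 cf [H [dH H0 Hy]].
(* Only the right limit of [H] at 0 is known; the value 0 makes [G] right-continuous there. *)
pose G x := if 0 < x then H x else 0.
have dG x : 0 < x -> is_derive x 1 G (f x).
  move=> x0; apply: near_eq_is_derive (dH x x0).
  near=> y; rewrite /G ifT //; near: y.
  exact: lt_nbhsr.
have G0 : G 0 = 0 by rewrite /G ltxx.
have G0' : G x @[x --> 0^'+] --> (0 : R).
  apply: cvg_trans H0; apply: near_eq_cvg; near=> x.
  by rewrite /G ifT //; near: x; exact: nbhs_right_gt.
have Gy : G x @[x --> +oo] --> l.
  apply: cvg_trans Hy; apply: near_eq_cvg; near=> x.
  by rewrite /G ifT //; near: x; apply: nbhs_pinfty_gt; exact: num_real.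
rewrite (@Rintegral_ge0_continuous_FTC2y _ f G 0 l) ?G0 ?subr0 //.
- apply/continuous_within_itvcyP; split.
    by move=> x; rewrite in_itv /= andbT => x0; apply: cf; exact: ltW.
  by apply: cvg_at_right_filter; exact: cf.
- by move=> x /dG [].
- move=> x; rewrite in_itv /= andbT => x0.
  by rewrite derive1E; case: (dG x x0).
Unshelve. all: by end_near. Qed.

End Deriv.

(** * Complex-valued functions of a real variable, through real and imaginary parts *)

Section ComplexFunctions.
Variable R : realType.
Implicit Types (f g : R -> R[i]) (x : R).

Lemma Re_mul (z t : R[i]) :
  complex.Re (z * t) = complex.Re z * complex.Re t - complex.Im z * complex.Im t.
Proof. by case: z t => [? ?] [? ?]. Qed.

Lemma Im_mul (z t : R[i]) :
  complex.Im (z * t) = complex.Re z * complex.Im t + complex.Im z * complex.Re t.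
Proof. by case: z t => [? ?] [? ?]. Qed.

Lemma Re_add (z t : R[i]) : complex.Re (z + t) = complex.Re z + complex.Re t.
Proof. by case: z t => [? ?] [? ?]. Qed.

Lemma Im_add (z t : R[i]) : complex.Im (z + t) = complex.Im z + complex.Im t.
Proof. by case: z t => [? ?] [? ?]. Qed.

Definition is_cderive x f (df : R[i]) : Prop :=
  is_derive x 1 (fun y => complex.Re (f y)) (complex.Re df) /\
  is_derive x 1 (fun y => complex.Im (f y)) (complex.Im df).

Lemma is_cderiveM x f g df dg : is_cderive x f df -> is_cderive x g dg ->
  is_cderive x (fun y => f y * g y) (df * g x + f x * dg).
Proof.
move=> [fr fi] [gr gi]; split.
  rewrite (_ : (fun y => _) = (fun y => complex.Re (f y) * complex.Re (g y) +
      - (complex.Im (f y) * complex.Im (g y)))); last first.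
    by apply/funext => y; rewrite Re_mul.
  apply: is_derive_eq; rewrite Re_add !Re_mul.
  by rewrite /GRing.scale /=; ring.
rewrite (_ : (fun y => _) = (fun y => complex.Re (f y) * complex.Im (g y) +
    complex.Im (f y) * complex.Re (g y))); last first.
  by apply/funext => y; rewrite Im_mul.
apply: is_derive_eq; rewrite Im_add !Im_mul.
by rewrite /GRing.scale /=; ring.
Qed.

Lemma is_cderiveX x f n df : is_cderive x f df ->
  is_cderive x (fun y => f y ^+ n.+1) (n.+1%:R * f x ^+ n * df).
Proof.
move=> hf; elim: n => [|n IH].
  by rewrite mul1r expr0 mul1r; under eq_fun do rewrite expr1.
under eq_fun do rewrite exprS.
have := is_cderiveM hf IH.
rewrite (_ : _ + _ = n.+2%:R * f x ^+ n.+1 * df) //.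
by rewrite -[n.+2]addn1 natrD exprS; ring.
Qed.

Definition ccvg (F : set_system R) f (l : R[i]) : Prop :=
  complex.Re (f x) @[x --> F] --> complex.Re l /\
  complex.Im (f x) @[x --> F] --> complex.Im l.

Lemma ccvgM (F : set_system R) (FF : Filter F) f g k l : ccvg F f k ->
  ccvg F g l -> ccvg F (fun x => f x * g x) (k * l).
Proof.
move=> [fr fi] [gr gi]; split.
  rewrite Re_mul (_ : (fun y => _) = (fun y => complex.Re (f y) * complex.Re (g y) -
      (complex.Im (f y) * complex.Im (g y)))); last first.
    by apply/funext => y; rewrite Re_mul.
  by apply: cvgB; apply: cvgM.
rewrite Im_mul (_ : (fun y => _) = (fun y => complex.Re (f y) * complex.Im (g y) +
    complex.Im (f y) * complex.Re (g y))); last first.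
  by apply/funext => y; rewrite Im_mul.
by apply: cvgD; apply: cvgM.
Qed.

Lemma ccvgX (F : set_system R) (FF : Filter F) f n l : ccvg F f l ->
  ccvg F (fun x => f x ^+ n.+1) (l ^+ n.+1).
Proof.
move=> fl; elim: n => [|n IH]; first by under eq_fun do rewrite expr1.
by rewrite exprS; under eq_fun do rewrite exprS; exact: ccvgM.
Qed.

Lemma is_cderive_ccvg x f df : is_cderive x f df -> ccvg x^'+ f (f x).
Proof.
move=> [fr fi]; split; apply: cvg_at_right_filter.
  exact: is_derive_continuous fr.
exact: is_derive_continuous fi.
Qed.

End ComplexFunctions.

(** * Reduction formulas for powers of 1 / (y^2 + 2by + 1) on the imaginary axis *)

Section Zeta.
Variables (R : realType) (b : R).
Hypothesis b_gt0 : 0 < b.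

(** This is |y^2 + 2by + 1|^2 at y = ix, that is (1 - x^2)^2 + 4 b^2 x^2. *)
Definition quartic (x : R) : R := x ^+ 4 + 2 * (2 * b ^+ 2 - 1) * x ^+ 2 + 1.

(* 1 / (y^2 + 2by + 1) at y = ix *)
Definition zeta (x : R) : R[i] :=
  ((1 - x ^+ 2) / quartic x) +i* (- (2 * b * x) / quartic x).

(* y + b at y = ix *)
Definition upsilon (x : R) : R[i] := b +i* x.

(** As (1 + x^2)^2 = (1 - x^2)^2 + 4 x^2, the constant min(1, b^2) works. *)
Lemma quartic_ge : exists2 c, 0 < c & forall x, c * (1 + x ^+ 2) ^+ 2 <= quartic x.
Proof.
have [b1|b1] := leP b 1.
  exists (b ^+ 2); first by rewrite exprn_gt0.
  move=> x; rewrite -subr_ge0 /quartic.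
  rewrite (_ : _ - _ = (1 - b ^+ 2) * (1 - x ^+ 2) ^+ 2); last by ring.
  by rewrite mulr_ge0 ?sqr_ge0 // subr_ge0 expr_le1 // ltW.
exists 1 => // x; rewrite -subr_ge0 /quartic.
rewrite (_ : _ - _ = 4 * (b ^+ 2 - 1) * x ^+ 2); last by ring.
rewrite mulr_ge0 ?sqr_ge0 // mulr_ge0 // subr_ge0; exact/exprn_ege1/ltW.
Qed.

Lemma quartic_gt0 x : 0 < quartic x.
Proof.
have [c c0 cq] := quartic_ge; apply: lt_le_trans (cq x).
by rewrite mulr_gt0 // exprn_gt0 // ltr_wpDr ?sqr_ge0.
Qed.

Lemma zetaE x : (1 - x ^+ 2) +i* (2 * b * x) * zeta x = 1.
Proof.
have := lt0r_neq0 (quartic_gt0 x); rewrite /zeta /quartic => q0.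
apply/eqP; rewrite eq_complex /=; apply/andP; split; apply/eqP; field; exact: q0.
Qed.

Lemma is_derive_quartic (x : R) :
  is_derive x 1 quartic (4 * x ^+ 3 + 4 * (2 * b ^+ 2 - 1) * x).
Proof.
rewrite /quartic; apply: is_derive_eq.
by rewrite /GRing.scale /=; ring.
Qed.

(** For Q = y^2 + 2by + 1 along y = ix, the derivative of 1/Q in x is -i Q'/Q^2, with Q' = 2 (y +
    b). *)
Lemma is_cderive_zeta x : is_cderive x zeta (- (2 * 'i%C) * (upsilon x * zeta x ^+ 2)).
Proof.
have q0 := lt0r_neq0 (quartic_gt0 x).
have dq := is_derive_quartic x.
by split; rewrite /zeta /=; apply: is_derive_eq; move: q0; rewrite /quartic => q0;
  rewrite /GRing.scale /=; field; exact: q0.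
Qed.

Lemma is_cderive_upsilon x : is_cderive x upsilon 'i%C.
Proof. by split; [exact: is_derive_cst|exact: is_derive_id]. Qed.


(** The hypothesis says that f grows at most like x^3, so the quotient is O(1/x). *)
Lemma cvg_div_quartic (f : R -> R) (K : R) :
  (forall x, 1 <= x -> `|f x| * x <= K * (1 + x ^+ 2) ^+ 2) ->
  f x / quartic x @[x --> +oo] --> (0 : R).
Proof.
move=> fK; have [c c0 cq] := quartic_ge.
apply: (@cvg_pinfty0 _ _ (K / c)) => x x1.
have x0 : 0 < x by lra.
rewrite normrM normfV (gtr0_norm (quartic_gt0 x)) ler_pdivrMr ?quartic_gt0 //.
rewrite mulrAC ler_pdivlMr //; apply: le_trans (fK x x1) _.
have K0 : 0 <= K.
  have := fK x x1; apply: contraTT; rewrite -!ltNge => K0.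
  apply: lt_le_trans (mulr_ge0 (normr_ge0 _) (ltW x0)).
  by rewrite nmulr_rlt0 // exprn_gt0 // ltr_wpDr ?sqr_ge0.
rewrite mulrAC ler_pdivlMr // (_ : _ * c = K * (c * (1 + x ^+ 2) ^+ 2)); last by ring.
exact: ler_wpM2l.
Qed.

Lemma ccvg_zeta : ccvg +oo zeta 0.
Proof.
split.
  apply: (@cvg_div_quartic (fun x => 1 - x ^+ 2) 1) => x x1.
  by rewrite ler0_norm; nra.
apply: (@cvg_div_quartic (fun x => - (2 * b * x)) (2 * b)) => x x1.
have x0 : 0 <= x by lra.
have bx : 0 <= b * x by apply: mulr_ge0 => //; exact: ltW.
have -> : `|- (2 * b * x)| * x = 2 * b * (x ^+ 2) by rewrite normrN -mulrA ger0_norm; [ring|lra].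
apply: ler_wpM2l; first by rewrite mulr_ge0 ?ltW.
by have := sqr_ge0 x; nra.
Qed.

Lemma ccvg_upsilon_zeta : ccvg +oo (fun x => upsilon x * zeta x) 0.
Proof.
split.
  rewrite (_ : (fun x => _) = (fun x => (b * (1 + x ^+ 2)) / quartic x)); last first.
    by apply/funext => x; rewrite Re_mul /=; ring.
  apply: cvg_div_quartic b _ => x x1.
  have x0 : 0 <= x by lra.
  have -> : `|b * (1 + x ^+ 2)| * x = b * ((1 + x ^+ 2) * x).
    by rewrite ger0_norm; [ring|apply: mulr_ge0; [exact: ltW|nra]].
  by apply: ler_wpM2l; [exact: ltW|nra].
rewrite (_ : (fun x => _) =
    (fun x => (x * (1 - x ^+ 2) - 2 * b ^+ 2 * x) / quartic x)); last first.
  by apply/funext => x; rewrite Im_mul /=; ring.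
apply: cvg_div_quartic (1 + 2 * b ^+ 2) _ => x x1.
have x0 : 0 <= x by lra.
have b2 := sqr_ge0 b; have x2 := sqr_ge0 x.
rewrite ler0_norm; last by rewrite subr_le0; apply: (@le_trans _ _ 0); nra.
rewrite (_ : _ * x = x ^+ 2 * (x ^+ 2 - 1) + 2 * b ^+ 2 * x ^+ 2); last by ring.
rewrite [X in _ <= X]mulrDl mul1r; apply: lerD; first by nra.
by apply: ler_wpM2l; [rewrite mulr_ge0|nra].
Qed.

Lemma zeta0 : zeta 0 = 1.
Proof.
have q0 : quartic 0 = 1 by rewrite /quartic; ring.
by rewrite /zeta q0; apply/eqP; rewrite eq_complex /=; apply/andP; split; apply/eqP; field.
Qed.

Lemma variation_Im (f df : R -> R[i]) : (forall x, is_cderive x f (df x)) ->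
  complex.Im (f 0) = 0 -> ccvg +oo f 0 -> has_variation (fun x => complex.Im (df x)) 0.
Proof.
move=> dF f0 [_ fy]; exists (fun x => complex.Im (f x)); split => //.
  by move=> x _; case: (dF x).
by have [_] := is_cderive_ccvg (dF 0); rewrite f0.
Qed.

Lemma Im_mulri (r : R) (z : R[i]) : complex.Im (r%:C * 'i%C * z) = r * complex.Re z.
Proof. by case: z => u v; simpc. Qed.

Lemma natrC n : n%:R = (n%:R)%:C :> R[i].
Proof. by rewrite rmorph_nat. Qed.

(** The derivative of zeta^(k+1) is -2(k+1) i upsilon zeta^(k+2), and zeta^(k+1) is real at 0 and
    vanishes at infinity. *)
Lemma variation_upsilon_zeta k :
  has_variation (fun x => complex.Re (upsilon x * zeta x ^+ k.+2)) 0.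
Proof.
have := variation_Im (fun x => is_cderiveX k (is_cderive_zeta x)).
rewrite zeta0 expr1n => /(_ erefl).
have -> : (0 : R[i]) = 0 ^+ k.+1 by rewrite expr0n.
move=> /(_ (ccvgX _ _ ccvg_zeta)) /(has_variationZ (- (2 * k.+1%:R))^-1).
rewrite mulr0; apply: eq_has_variation => x x0.
rewrite (_ : _ * _ = (- (2 * k.+1%:R))%:C * 'i%C * (upsilon x * zeta x ^+ k.+2)).
  rewrite Im_mulri mulKf // oppr_eq0 mulf_neq0 // pnatr_eq0 //.
by rewrite rmorphN rmorphM /= -!natrC !exprS; ring.
Qed.

(** This is (y + b)^2 = Q + b^2 - 1 divided by Q. *)
Lemma upsilon_sqr x : upsilon x ^+ 2 * zeta x = 1 + (b ^+ 2 - 1)%:C * zeta x.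
Proof.
rewrite -{1}(zetaE x) -mulrDl; congr (_ * _).
by apply/eqP; rewrite eq_complex /=; apply/andP; split; apply/eqP; ring.
Qed.

(** Differentiating upsilon zeta^(k+1), equal to b at 0, and eliminating upsilon^2 by [upsilon_sqr]
    links consecutive powers of zeta. *)
Lemma variation_zeta_rec k :
  has_variation (fun x => - (2 * k%:R + 1) * complex.Re (zeta x ^+ k.+1) +
    2 * k.+1%:R * (1 - b ^+ 2) * complex.Re (zeta x ^+ k.+2)) 0.
Proof.
have := variation_Im (fun x =>
  is_cderiveM (is_cderive_upsilon x) (is_cderiveX k (is_cderive_zeta x))).
have I0 : complex.Im (upsilon 0 * 1) = 0 by rewrite mulr1.
rewrite zeta0 expr1n => /(_ I0) H.
have /H : ccvg +oo (fun x => upsilon x * zeta x ^+ k.+1) 0.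
  (* Since upsilon is unbounded, one factor zeta is kept with it; the others tend to 0
     separately. *)
  case: k {H} => [|k]; first exact: ccvg_upsilon_zeta.
  under eq_fun do rewrite exprS mulrA.
  rewrite -[0](mul0r (0 ^+ k.+1)).
  by apply: ccvgM; [exact: ccvg_upsilon_zeta|exact: ccvgX ccvg_zeta].
apply: eq_has_variation => x x0.
rewrite (_ : _ + _ = 1%:C * 'i%C * ((- (2 * k%:R + 1))%:C * zeta x ^+ k.+1 +
    (2 * k.+1%:R * (1 - b ^+ 2))%:C * zeta x ^+ k.+2)).
  by rewrite Im_mulri Re_add !Re_mul /= !mul0r !subr0 mul1r.
rewrite (_ : upsilon x * _ = - (2 * k.+1%:R * 'i%C) * zeta x ^+ k.+1 *
   (upsilon x ^+ 2 * zeta x)); last by rewrite !exprS; ring.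
rewrite upsilon_sqr !exprS rmorph1 !(rmorphN, rmorphM, rmorphD, rmorphB) /=.
rewrite !rmorph1 -!natrC -[k.+1]addn1 natrD. ring.
Qed.

End Zeta.

(** * Variations of the powers of zeta and of upsilon zeta *)

Section Zeta.
Variables (R : realType) (b : R).
Hypothesis b_gt0 : 0 < b.
Local Notation quartic := (quartic b).
Local Notation zeta := (zeta b).
Local Notation upsilon := (upsilon b).

(* v = x / (1 + x^2) runs from 0 to 1/2 and back as x runs over the half-line, and
   (1 - x^2) dx / quartic x = dv / (1 + 4 (b^2 - 1) v^2). *)
Lemma variation_Re_zeta (Phi : R -> R) : Phi 0 = 0 ->
  (forall v : R, 0 <= v <= 2^-1 ->
    is_derive v 1 Phi (1 + 4 * (b ^+ 2 - 1) * v ^+ 2)^-1) ->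
  has_variation (fun x => complex.Re (zeta x)) 0.
Proof.
move=> Phi0 dPhi.
have q1 x : 0 < 1 + x ^+ 2 :> R by rewrite ltr_wpDr ?sqr_ge0.
have q2 (x : R) : 1 + x ^+ 2 != 0 by exact/lt0r_neq0.
have cPhi : Phi x @[x --> (0 : R)] --> (0 : R).
  have c0 : {for (0 : R), continuous Phi}.
    by apply: is_derive_continuous (dPhi 0 _); rewrite lexx invr_ge0 /=.
  by rewrite -[X in _ --> X]Phi0; exact: c0.
have dv (x : R) : is_derive x 1 (fun y => y / (1 + y ^+ 2))
    ((1 - x ^+ 2) / (1 + x ^+ 2) ^+ 2).
  have qx := q2 x.
  by apply: is_derive_eq; rewrite /GRing.scale /=; field.
exists (fun x => Phi (x / (1 + x ^+ 2))); split.
- move=> x x0; apply: is_derive_eq_fun.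
    apply: is_derive_comp_fun (dv x); apply: dPhi.
    apply/andP; split; first by apply: divr_ge0; exact: ltW.
    by rewrite ler_pdivrMr //; have := sqr_ge0 (x - 1); nra.
  have := lt0r_neq0 (quartic_gt0 b_gt0 x); have := q2 x.
  rewrite /zeta /quartic /= => qx qq.
  by field; rewrite qq.
- apply: cvg_comp cPhi; apply: cvg_at_right_filter.
  have := is_derive_continuous (dv 0); rewrite /prop_for /continuous_at.
  by rewrite mul0r; exact.
- apply: cvg_comp cPhi; apply: (@cvg_pinfty0 _ _ 1) => x x1.
  have x0 : 0 < x by lra.
  rewrite ger0_norm; last by apply: divr_ge0; exact: ltW.
  by rewrite ler_pdivrMr // mulrAC ler_pdivlMr //; nra.
Qed.

(** The primitive in v is a logarithm for b < 1 and an arctangent for b > 1. *)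
Lemma variation_Re_zeta_neq1 : b != 1 ->
  has_variation (fun x => complex.Re (zeta x)) 0.
Proof.
have b2 : 0 < b ^+ 2 by rewrite exprn_gt0.
rewrite neq_lt => /orP[b1|b1].
  have d0 : 0 < 1 - b ^+ 2 by rewrite subr_gt0 expr_lt1 // ltW.
  pose s := 2 * Num.sqrt (1 - b ^+ 2).
  have s0 : 0 < s by rewrite mulr_gt0 // sqrtr_gt0.
  have ss : s ^+ 2 = 4 * (1 - b ^+ 2).
    by rewrite exprMn sqr_sqrtr ?ltW //; ring.
  (* For v <= 1/2 this keeps 1 - s v positive. *)
  have s2 : s < 2 by nra.
  apply: (@variation_Re_zeta (fun v => (ln (1 + s * v) - ln (1 - s * v)) / (2 * s))).
    by rewrite mulr0 addr0 subr0 subrr mul0r.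
  move=> v /andP[v0 v1].
  have p1 : 0 < 1 + s * v by nra.
  have p2 : 0 < 1 - s * v by nra.
  have l1 := is_derive1_ln p1.
  have l2 := is_derive1_ln p2.
  apply: is_derive_eq_fun.
  rewrite /GRing.scale /=.
  rewrite (_ : 1 + _ * v ^+ 2 = (1 + s * v) * (1 - s * v)); last first.
    have -> : 4 * (b ^+ 2 - 1) = - s ^+ 2 by rewrite ss; ring.
    by ring.
  by field; rewrite !lt0r_neq0.
have d0 : 0 < b ^+ 2 - 1 by rewrite subr_gt0 exprn_egt1.
pose s := 2 * Num.sqrt (b ^+ 2 - 1).
have s0 : 0 < s by rewrite mulr_gt0 // sqrtr_gt0.
have ss : s ^+ 2 = 4 * (b ^+ 2 - 1).
  by rewrite exprMn sqr_sqrtr ?ltW //; ring.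
apply: (@variation_Re_zeta (fun v => atan (s * v) / s)).
  by rewrite mulr0 atan0 mul0r.
move=> v _; apply: is_derive_eq_fun.
rewrite exprMn ss /GRing.scale /=; field.
rewrite [s != 0]lt0r_neq0 // andbT; apply: lt0r_neq0.
by have := mulr_ge0 (ltW d0) (sqr_ge0 v); lra.
Qed.

(** For b = 1 the second term of the recurrence vanishes, which settles every power at once.
    Otherwise 1 - b^2 is invertible and the recurrence leads from k to k+1. *)
Lemma variation_zeta k : has_variation (fun x => complex.Re (zeta x ^+ k.+1)) 0.
Proof.
have [b1|b1] := eqVneq b 1.
  have := has_variationZ (- (2 * k%:R + 1))^-1 (variation_zeta_rec b_gt0 k).
  rewrite mulr0; apply: eq_has_variation => x x0.
  rewrite b1 expr1n subrr mulr0 mul0r addr0 mulKf // oppr_eq0 lt0r_neq0 //.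
elim: k => [|k IH]; first exact: variation_Re_zeta_neq1.
have := has_variationZ (2 * k.+1%:R * (1 - b ^+ 2))^-1
  (has_variationD (has_variationZ (2 * k%:R + 1) IH) (variation_zeta_rec b_gt0 k)).
rewrite mulr0 addr0 mulr0; apply: eq_has_variation => x x0.
rewrite addrA -mulrDl subrr mul0r add0r mulKf // !mulf_neq0 ?pnatr_eq0 //.
by rewrite subr_eq0 eq_sym sqrf_eq1 negb_or b1 /= gt_eqF // (lt_trans _ b_gt0) // oppr_lt0.
Qed.

(** The function is b (1 + x^2) / quartic x, and t = (x - 1/x) / (2b) turns it into dt / (2 (1 +
    t^2)), with t running over the whole real line. *)
Lemma variation_upsilon_zeta1 :
  has_variation (fun x => complex.Re (upsilon x * zeta x)) (pi / 2).
Proof.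
exists (fun x => 2^-1 * atan ((x - x^-1) / (2 * b)) + pi / 4); split.
- move=> x x0; have x0' := lt0r_neq0 x0.
  have dV : is_derive x 1 (fun y : R => y^-1) (- x ^- 2 * 1).
    exact: (@is_deriveV_fun _ id x 1 x0').
  apply: is_derive_eq_fun.
  have := lt0r_neq0 (quartic_gt0 b_gt0 x).
  rewrite Re_mul /= /GRing.scale /quartic /= => qq.
  by field; rewrite qq x0' lt0r_neq0.
- have inv_y : (x^-1 - x) / (2 * b) @[x --> (0 : R)^'+] --> +oo.
    apply/cvgryPge => A; near=> x.
    have x0 : 0 < x by near: x; exact: nbhs_right_gt.
    have x1 : x < 1 by near: x; exact: nbhs_right_lt.
    rewrite ler_pdivlMr ?mulr_gt0 // lerBrDr.
    apply: (@le_trans _ _ (`|A * (2 * b)| + 1)); first by rewrite lerD ?ler_norm ?ltW.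
    have p : 0 < `|A * (2 * b)| + 1 by rewrite ltr_wpDl.
    have xA : x < (`|A * (2 * b)| + 1)^-1.
      by near: x; apply: nbhs_right_lt; rewrite invr_gt0 ltr_wpDl.
    by rewrite -[X in X <= _]invrK lef_pV2 ?posrE ?invr_gt0 // ltW.
  rewrite (_ : (fun x => _) =
      (fun x => (- 2^-1) * atan ((x^-1 - x) / (2 * b)) + pi / 4)); last first.
    by apply/funext => x; rewrite -[x - _]opprB mulNr atanN mulrN mulNr.
  have := cvgD (cvgM (cvg_cst (- 2^-1 : R)) (cvg_comp _ _ inv_y (@cvgy_atan R)))
    (cvg_cst (pi / 4)).
  rewrite (_ : - 2^-1 * _ + _ = 0); first exact.
  by field.
- have y_y : (x - x^-1) / (2 * b) @[x --> +oo] --> +oo.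
    apply/cvgryPge => A; near=> x.
    have x1 : 1 <= x by near: x; apply: nbhs_pinfty_ge; exact: num_real.
    rewrite ler_pdivlMr ?mulr_gt0 // lerBrDr.
    have : x^-1 <= 1 by rewrite invf_le1 //; lra.
    have : A * (2 * b) + 1 <= x by near: x; apply: nbhs_pinfty_ge; exact: num_real.
    by lra.
  have := cvgD (cvgM (cvg_cst (2^-1 : R)) (cvg_comp _ _ y_y (@cvgy_atan R)))
    (cvg_cst (pi / 4)).
  rewrite (_ : 2^-1 * _ + _ = pi / 2); first exact.
  by field.
Unshelve. all: by end_near. Qed.

End Zeta.

(** * From the integral to a Bezout coefficient *)

Section Quadratic.
Variables (R : realType) (b : R).
Hypothesis b_gt0 : 0 < b.
Local Notation quartic := (quartic b).
Local Notation zeta := (zeta b).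
Local Notation upsilon := (upsilon b).

Definition quadratic (c : R) : {poly R} := 'X^2 + (2 * c) *: 'X + 1.

Lemma size_quadratic c : size (quadratic c) = 3.
Proof.
rewrite /quadratic -addrA size_polyDl size_polyXn //.
rewrite (leq_ltn_trans (size_polyD _ _)) // size_poly1 gtn_max.
by rewrite (leq_ltn_trans (size_scale_leq _ _)) ?size_polyX.
Qed.

Lemma quadratic_neq0 c : quadratic c != 0.
Proof. by rewrite -size_poly_eq0 size_quadratic. Qed.

Definition ihorner (p : {poly R}) (x : R) : R[i] :=
  (map_poly (real_complex R) p).[0 +i* x].

Lemma ihornerD p q x : ihorner (p + q) x = ihorner p x + ihorner q x.
Proof. by rewrite /ihorner rmorphD hornerD. Qed.

Lemma ihornerM p q x : ihorner (p * q) x = ihorner p x * ihorner q x.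
Proof. by rewrite /ihorner rmorphM hornerM. Qed.

Lemma ihornerC c x : ihorner c%:P x = c%:C.
Proof. by rewrite /ihorner map_polyC hornerC. Qed.

Lemma ihorner1 x : ihorner 1 x = 1.
Proof. by rewrite -polyC1 ihornerC. Qed.

Lemma ihornerX x : ihorner 'X x = 0 +i* x.
Proof. by rewrite /ihorner map_polyX hornerX. Qed.

Lemma ihorner_quadratic c x : ihorner (quadratic c) x = (1 - x ^+ 2) +i* (2 * c * x).
Proof.
rewrite /quadratic -mul_polyC expr2 !(ihornerD, ihornerM, ihornerX, ihornerC, ihorner1).
by apply/eqP; rewrite eq_complex /=; apply/andP; split; apply/eqP; ring.
Qed.

Lemma has_variation0 : has_variation (fun=> 0 : R) 0.
Proof.
by exists (fun=> 0); split => [x _||]; [exact: is_derive_cst|exact: cvg_cst|exact: cvg_cst].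
Qed.

(** Induction through B = B1 Q + r: the factor Q lowers the power of zeta, and r = r_1 (y + b) +
    (r_0 - b r_1) leaves the known variations of upsilon zeta^(n+1) and zeta^(n+1). *)
Lemma variation_ihorner n (B : {poly R}) : (size B <= n.*2)%N ->
  has_variation (fun x => complex.Re (ihorner B x * zeta x ^+ n))
    (pi / 2 * B`_n.*2.-1).
Proof.
elim: n B => [|n IH] B.
  rewrite leqn0 size_poly_eq0 => /eqP ->; rewrite coef0 mulr0.
  by apply: eq_has_variation has_variation0 => x _; rewrite ihornerC mul0r.
move=> sB; pose B1 := B %/ quadratic b; pose r := B %% quadratic b.
have BE : B = B1 * quadratic b + r := divp_eq _ _.
have sB1 : (size B1 <= n.*2)%N.
  by rewrite size_divp ?quadratic_neq0 // size_quadratic leq_subLR.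
have sr : (size r <= 2)%N.
  by have := ltn_modp B (quadratic b); rewrite quadratic_neq0 size_quadratic ltnS.
have rE : r = (r`_1)%:P * 'X + (r`_0)%:P.
  by apply/polyP => -[|[|i]]; rewrite coefD coefMX !coefC /= ?addr0 ?add0r //
    nth_default // (leq_trans sr).
(* The top coefficient passes from B to B1, except for n = 0, where B1 = 0 and it is r_1. *)
have lead : B`_(n.+1).*2.-1 = B1`_n.*2.-1 + r`_1 *+ (n == 0)%N.
  rewrite [in LHS]BE /quadratic !mulrDr mulr1 -scalerAr !coefD coefZ coefMX coefMXn /=.
  have B1_0 i : (n.*2 <= i)%N -> B1`_i = 0.
    by move=> ni; rewrite nth_default // (leq_trans sB1).
  rewrite (B1_0 n.*2) // (B1_0 n.*2.+1) // mulr0 !addr0.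
  case: n B1_0 {IH sB sB1} => [|n] B1_0 /=; first by rewrite B1_0 // add0r.
  by rewrite mulr0n addr0 [r`__]nth_default ?addr0 ?subn2 // (leq_trans sr).
rewrite lead mulrDr.
have := has_variationD (IH _ sB1) (has_variationD
  (_ : has_variation (fun x => r`_1 * complex.Re (upsilon x * zeta x ^+ n.+1))
        (pi / 2 * (r`_1 *+ (n == 0)%N)))
  (has_variationZ (r`_0 - b * r`_1) (variation_zeta b_gt0 n))).
rewrite mulr0 addr0 => H; apply: eq_has_variation (H _) => {H}.
  move=> x x0.
  have -> : ihorner B x * zeta x ^+ n.+1 =
      ihorner B1 x * zeta x ^+ n + ihorner r x * zeta x ^+ n.+1.
    rewrite {1}BE ihornerD ihornerM ihorner_quadratic mulrDl -mulrA.
    by congr (_ * _ + _); rewrite [zeta x ^+ _]exprS mulrA zetaE // mul1r.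
  rewrite Re_add; congr (_ + _).
  rewrite [in RHS]rE ihornerD ihornerM ihornerX !ihornerC.
  by rewrite !Re_mul /=; ring.
case: n {IH sB sB1 lead} => [|n].
  rewrite mulr1n mulrC; apply: has_variationZ.
  by under eq_fun do rewrite expr1; exact: variation_upsilon_zeta1.
rewrite mulr0n mulr0 -[X in has_variation _ X](mulr0 r`_1); apply: has_variationZ.
exact: variation_upsilon_zeta.
Qed.

(** At ix, [quadratic (- b)] is the conjugate of Q, hence quartic x times zeta x, and X U(X^2) is
    purely imaginary. The real part of the identity is 1 / quartic^n = Re (C zeta^n). *)
Lemma integral_of_bezout n (C U : {poly R}) : (size C <= n.*2)%N ->
  quadratic (- b) ^+ n * C + 'X * (U \Po 'X^2) = 1 ->
  \int[@lebesgue_measure R]_(x in `[0, +oo[) (quartic x ^+ n)^-1 =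
  pi / 2 * C`_n.*2.-1.
Proof.
move=> sC bez; apply: variation_integral.
- by move=> x _; rewrite invr_ge0 exprn_ge0 // ltW // quartic_gt0.
- move=> x _; apply: is_derive_continuous.
  have dq := is_derive_quartic b x; apply: is_deriveV_fun; last exact: is_deriveX_fun dq.
  by rewrite expf_neq0 // lt0r_neq0 // quartic_gt0.
apply: eq_has_variation (variation_ihorner sC) => x x0.
have q0 : quartic x != 0 by rewrite lt0r_neq0 // quartic_gt0.
have conjE : ihorner (quadratic (- b)) x = (quartic x)%:C * zeta x.
  rewrite ihorner_quadratic /zeta; apply/eqP; rewrite eq_complex /=.
  by apply/andP; split; apply/eqP; field.
have comp2 : ihorner (U \Po 'X^2) x = (U.[- x ^+ 2])%:C.
  rewrite /ihorner map_comp_poly horner_comp map_polyXn hornerXn.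
  rewrite -horner_map; congr (_.[_]).
  by apply/eqP; rewrite eq_complex /=; apply/andP; split; apply/eqP; ring.
have := congr1 (fun p => ihorner p x) bez.
rewrite ihornerD !ihornerM comp2 ihornerX ihorner1.
have ihX p k : ihorner (p ^+ k) x = ihorner p x ^+ k.
  by elim: k => [|k IH]; rewrite ?expr0 ?ihorner1 // !exprS ihornerM IH.
rewrite ihX conjE exprMn -rmorphXn /= -mulrA [_ * ihorner C x]mulrC => E.
have := congr1 (@complex.Re R) E.
rewrite Re_add !Re_mul /= !mul0r !mulr0 !subr0 addr0 => E'.
by apply: (mulfI (expf_neq0 n q0)); rewrite divff ?expf_neq0.
Qed.

End Quadratic.

Lemma schur_staircase_ratio (F : fieldType) N (q : 'I_N -> F) (C U : {poly F}) :
  (0 < N)%N -> ~~ odd N -> 2 != 0 :> F -> \prod_i q i = 1 ->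
  (size C <= N)%N -> (size U <= N)%N ->
  root_poly q * C + 'X * (U \Po 'X^2) = 1 ->
  meval q (schur F N (staircase N.-1)) / meval q (schur F N (staircase N)) =
  C`_N.-1.
Proof.
case: N q => // N q _ /negPn oddN two q1 sC sU bez.
have sE n : meval q (schur F N.+1 (staircase n)) =
    \det (remmx (root_poly q) (fun j : 'I_N.+1 => 'X^((n.-1 - j) + (N - j)))).
  apply: etrans (meval_schur q (staircase n)) _; congr (\det _).
  by apply/matrixP => k j; rewrite !mxE nth_staircase.
apply: etrans (congr2 (fun x y => x / y) (sE N) (sE N.+1)) _.
rewrite (det_remmx_odd_even oddN sC sU bez q1) mulfK //.
exact: det_remmx_even_neq0 bez two.
Qed.

(** * Construction of C and U *)

Section Bezout.
Variables (R : realType) (b : R).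
Hypothesis b_gt0 : 0 < b.

Lemma quadratic_compN : quadratic (- b) \Po - 'X = quadratic b.
Proof.
rewrite /quadratic !rmorphD /= comp_polyZ rmorphXn /= comp_polyX rmorph1 sqrrN.
by rewrite scalerN -scaleNr mulrN opprK.
Qed.

Lemma coprime_quadratic : coprimep (quadratic (- b)) (quadratic b).
Proof.
apply/Bezout_eq1_coprimepP.
(* Half the sum of the quadratics is X^2 + 1, and their difference -4bX times X / (4b) removes
   X^2. *)
exists (2^-1%:P * (1 + (2 * b)^-1 *: 'X), 2^-1%:P * (1 - (2 * b)^-1 *: 'X)) => /=.
rewrite /quadratic -!mul_polyC.
have h1 : (2^-1)%:P * 2 = 1 :> {poly R}.
  by rewrite -(polyC_natr R 2) -polyCM mulVf.
have h2 : ((2 * b)^-1)%:P * (2 * b)%:P = 1 :> {poly R}.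
  by rewrite -polyCM mulVf // mulf_neq0 // lt0r_neq0.
rewrite mulrN polyCN.
move: h1 h2; move: (2^-1)%:P ((2 * b)^-1)%:P (2 * b)%:P => h g c h1 h2.
rewrite (_ : _ + _ = h * 2 * (1 + 'X^2 - g * c * 'X^2)); last by ring.
by rewrite h1 h2; ring.
Qed.

(** Symmetrising a relation u E(X) + v E(-X) = 1 under X -> -X gives a polynomial G, multiple of E,
    with G(X) + G(-X) = 2. Its even part is 1, and its odd part provides -U. *)
Lemma quadratic_bezout n : (0 < n)%N -> exists C U : {poly R},
  [/\ (size C <= n.*2)%N, (size U <= n.*2)%N &
    quadratic (- b) ^+ n * C + 'X * (U \Po 'X^2) = 1].
Proof.
move=> n0; set E := quadratic (- b) ^+ n.
pose Em := quadratic b ^+ n.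
have EmE : E \Po - 'X = Em by rewrite rmorphXn /= quadratic_compN.
have EEm : Em \Po - 'X = E.
  by rewrite -EmE -comp_polyA rmorphN /= comp_polyX opprK comp_polyXr.
have sX c : size (quadratic c ^+ n : {poly R}) = n.*2.+1.
  have := size_exp (quadratic c) n; rewrite size_quadratic /= => h.
  rewrite -[size _]prednK ?h ?mul2n //.
  by rewrite size_poly_gt0 expf_neq0 // quadratic_neq0.
have [[u v] /= uv] : exists u, u.1 * E + u.2 * Em = 1.
  apply/Bezout_eq1_coprimepP; rewrite coprimep_expl // coprimep_expr //.
  exact: coprime_quadratic.
have uvm : (u \Po - 'X) * Em + (v \Po - 'X) * E = 1.
  have := congr1 (fun p => p \Po - 'X) uv.
  by rewrite rmorphD !rmorphM rmorph1 /= EmE EEm.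
(* Reduction modulo E(-X) changes E C0 by a multiple of E(X) E(-X). *)
pose C0 := u + (v \Po - 'X); pose K := C0 %/ Em; pose C := C0 %% Em.
have C0E : C0 = K * Em + C := divp_eq _ _.
have C0m : C0 \Po - 'X = (u \Po - 'X) + v.
  by rewrite rmorphD /= -comp_polyA rmorphN /= comp_polyX opprK comp_polyXr.
have sC : (size C <= n.*2)%N.
  by have := ltn_modp C0 Em; rewrite sX ltnS expf_neq0 // quadratic_neq0.
pose G := E * C.
have sG : (size G <= (n.*2).*2)%N.
  by rewrite (leq_trans (size_polyMleq _ _)) // sX -[_.*2.*2]addnn leq_add2l.
have GE : G + (G \Po - 'X) = 2 - E * Em * (K + (K \Po - 'X)).
  have Cm : C0 \Po - 'X = (K \Po - 'X) * E + (C \Po - 'X).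
    by rewrite C0E rmorphD rmorphM /= EEm.
  rewrite /G rmorphM /= EmE.
  rewrite (_ : C = C0 - K * Em); last by rewrite C0E addrC addKr.
  rewrite rmorphB rmorphM /= EEm C0m -[2]/(1 + 1) -{1}uv -uvm /C0; ring.
have Gsum : G + (G \Po - 'X) = 2.
  (* A nonzero K(X) + K(-X) would force 2 - G(X) - G(-X) to have degree at least 4n, whereas G has
     degree below 4n. *)
  suff K0 : K + (K \Po - 'X) = 0 by rewrite GE K0 mulr0 subr0.
  apply/eqP; apply: contraT => K0.
  have : (size (2 - (G + (G \Po - 'X)))%R <= (n.*2).*2)%N.
    rewrite (leq_trans (size_polyD _ _)) // geq_max size_polyN.
    rewrite -(polyC_natr R 2) (leq_trans (size_polyC_leq1 _)) /=; last by lia.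
    rewrite (leq_trans (size_polyD _ _)) // geq_max sG /=.
    by rewrite size_comp_poly2 // size_polyN size_polyX.
  rewrite GE opprB addrC subrK size_mul ?mulf_neq0 ?expf_neq0 ?quadratic_neq0 //.
  rewrite size_mul ?expf_neq0 ?quadratic_neq0 // !sX.
  move: K0; rewrite -size_poly_gt0; move: (size _) => k; lia.
exists C, (- odd_poly G); split => //.
  rewrite size_polyN (leq_trans (size_odd_poly _)) //.
  by rewrite -[n.*2]doubleK half_leq.
have comp2 p : (p \Po 'X^2) \Po - 'X = p \Po 'X^2 :> {poly R}.
  by rewrite -comp_polyA rmorphXn /= comp_polyX sqrrN.
have Ge : even_poly G \Po 'X^2 = 1.
  have G2 := Gsum; rewrite -(poly_even_odd G) rmorphD rmorphM /= !comp2 comp_polyX in G2.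
  have two : 2 != 0 :> {poly R} by rewrite -(polyC_natr R 2) polyC_eq0 pnatr_eq0.
  by apply: (mulfI two); rewrite mulr1 -[RHS]G2; ring.
rewrite rmorphN /= -/G; apply/eqP; rewrite mulrN subr_eq -Ge mulrC.
by rewrite poly_even_odd.
Qed.

End Bezout.

(** * Specialisation to the tuple of copies of w and 1/w *)

Lemma prod_qtuple (R : rcfType) (S : comNzRingType) (f : R[i] -> S) m (w : R[i]) :
  \prod_i f (qtuple m w i) = f w ^+ m.+1 * f w^-1 ^+ m.+1.
Proof.
rewrite /qtuple -(big_mkord xpredT (fun i => f (if (i < m.+1)%N then w else w^-1))).
rewrite (big_cat_nat (n := m.+1)) //=; last by lia.
congr (_ * _).
  rewrite (eq_big_nat _ _ (F2 := fun=> f w)) ?prodr_const_nat ?subn0 // => i.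
  by case/andP => _ ->.
rewrite (eq_big_nat _ _ (F2 := fun=> f w^-1)).
  by rewrite prodr_const_nat; congr (_ ^+ _); lia.
by move=> i /andP[mi _]; rewrite ltnNge mi.
Qed.

Lemma root_poly_qtuple (R : realType) (b : R) m (w : R[i]) : w != 0 ->
  w + w^-1 = (2 * b)%:C ->
  root_poly (qtuple m w) = map_poly (real_complex R) (quadratic (- b) ^+ m.+1).
Proof.
move=> w0 wb; rewrite /root_poly (prod_qtuple (fun z => 'X - z%:P)) -exprMn rmorphXn /=.
congr (_ ^+ _); rewrite /quadratic !rmorphD /= map_polyXn map_polyZ map_polyX rmorph1.
rewrite mulrN rmorphN /= -wb -mul_polyC polyCN polyCD.
have ww : w%:P * w^-1%:P = 1 :> {poly R[i]} by rewrite -polyCM mulfV.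
by rewrite -[1]ww; ring.
Qed.

(** The square of w + 1/w is the real number 2a + 2, so the real and imaginary parts of the sum have
    product 0. The real part is positive, hence the sum is real. *)
Lemma real_half_sum (R : realType) (a : R) (w : R[i]) : -1 < a ->
  a%:C = 2^-1 * (w ^+ 2 + w ^- 2) -> 0 < complex.Re w ->
  exists2 b, 0 < b & a = 2 * b ^+ 2 - 1 /\ w + w^-1 = (2 * b)%:C.
Proof.
move=> ha hw hRe.
have w0 : w != 0 by apply: contraTneq hRe => ->; rewrite ltxx.
have s2 : (w + w^-1) ^+ 2 = (2 * a + 2)%:C.
  rewrite rmorphD rmorphM /= hw -exprVn.
  rewrite (_ : 2%:C = 2); last by rewrite rmorph_nat.
  by field.
have Rs : 0 < complex.Re (w + w^-1).
  rewrite Re_add ltr_wpDr //; case: w hRe {hw w0 s2} => x y /= x0.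
  by rewrite divr_ge0 ?addr_ge0 ?sqr_ge0 // ltW.
case: (w + w^-1) s2 Rs => x y /= /eqP.
rewrite expr2 eq_complex /= => /andP[/eqP e1 /eqP e2] x0.
have y0 : y = 0 by nra.
exists (x / 2); first by rewrite divr_gt0.
split.
  rewrite (_ : 2 * (x / 2) ^+ 2 = x * x / 2); last by field.
  by move: e1; rewrite y0; lra.
by rewrite y0 mulrC divfK.
Qed.

Theorem theorem3p1 (R : realType) (m : nat) (a : R) (w : R[i])
    (ha : -1 < a)
    (hw : a%:C = 2^-1 * (w ^+ 2 + w ^- 2))
    (hRe : 0 < complex.Re w) :
  (quartic_integral a m)%:C =
    (pi / 2)%:C *
    (meval (qtuple m w) (schur R[i] (2 * m + 2) (staircase (2 * m + 1))) /
     meval (qtuple m w) (schur R[i] (2 * m + 2) (staircase (2 * m + 2)))).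
Proof.
have [b b0 [ab wb]] := real_half_sum ha hw hRe.
have w0 : w != 0 by apply: contraTneq hRe => ->; rewrite ltxx.
have [C [U [sC sU bez]]] := quadratic_bezout b0 (ltn0Sn m).
have N2 : (m.+1).*2 = (2 * m + 2)%N by lia.
rewrite (_ : (2 * m + 1)%N = (2 * m + 2).-1); last by rewrite addn2 addn1.
(* The real polynomials C and U serve both sides: for the integral as they are, for the Schur
   quotient after extension of scalars. *)
rewrite (@schur_staircase_ratio _ _ _ (map_poly (real_complex R) C)
    (map_poly (real_complex R) U)).
- rewrite coef_map -N2 -rmorphM /quartic_integral ab; congr (_%:C).
  by rewrite -(integral_of_bezout b0 sC bez); exact: eq_Rintegral.
- by rewrite addn2.
- by rewrite oddD oddM.
- by rewrite pnatr_eq0.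
- by rewrite (prod_qtuple id) -exprMn mulfV // expr1n.
- by rewrite size_map_poly -N2.
- by rewrite size_map_poly -N2.
rewrite (root_poly_qtuple _ w0 wb) -(map_polyX (real_complex R)) -rmorphXn /=.
by rewrite -map_comp_poly -!rmorphM -rmorphD /= bez rmorph1.
Qed.
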